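(* Let $R$ be a proof-structure of $\mathsf{IMELL}$. Then $R\models\mathsf{ACC}_{\sharp\mathsf w}$ if and only if $R\models\mathsf{AC}$ and $\sharp\mathsf o(\mathcal G_R)=1$, where $\mathsf o(\mathcal G_R)$ is the set of $\bullet$ nodes of $\mathcal G_R$ whose premise has an output type.
   Context: Graphs. A graph $G$ consists of finite disjoint sets $N(G)$ (nodes), $A(G)$ (arcs) and functions $\mathrm{tail},\mathrm{head}:A(G)\to N(G)$ (loops and parallel arcs allowed). An arc $a$ is a conclusion of $\mathrm{tail}(a)$ and a premise of $\mathrm{head}(a)$; its ends are $\mathrm{tail}(a),\mathrm{head}(a)$. A path from $n_0$ to $n_k$ is an alternating sequence $n_0a_1n_1\dots a_kn_k$ ($k\ge 0$) of nodes and arcs such that the ends of $a_i$ are $n_{i-1}$ and $n_i$; $n_i=n_j$ with $i\ne j$ implies $\{i,j\}=\{0,k\}$; and $a_1\neq a_k$ if $k\ge2$. It is a cycle if $k>0$ and $n_0=n_k$. $G$ is acyclic if it has no cycle (orientation ignored). $\mathrm{cc}(G)$ is the set of (non-empty) connected components of $G$; $\sharp S$ is the cardinality of $S$. Ground-structures. Write $\wp$ for par. A ground-structure is a graph whose nodes carry labels in $\{\mathtt{ax},\mathtt{cut},\mathtt 1,\bot,\otimes,\wp,!,?\mathtt d,?,\bullet\}$ with the following numbers of premises and conclusions: $\mathtt{ax}$: 0 premises, 2 conclusions; $\mathtt{cut}$: 2, 0; $\mathtt 1$ and $\bot$: 0, 1; $\otimes$ and $\wp$: 2, 1; $!$: 0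 premises, at least 1 conclusion; $?\mathtt d$: 1, 1; $?$: any number $k\ge0$ of premises, 1 conclusion; $\bullet$: 1, 0. It is equipped with a total order on the set of premises of its $\bullet$ nodes (these arcs are the conclusions of the ground-structure), on the conclusions of each $!$ node, and on the premises of each $\otimes$ and $\wp$ node (left, right). A $?$ node with $0$ premises is a $?\mathtt w$ node; with at least $2$ premises a $?\mathtt c$ node. $\mathsf w(\mathcal G)$ is the set of $\bot$ and $?\mathtt w$ nodes of $\mathcal G$. Proof-structures. A proof-structure (of finite depth, inductively) is a pair $R=(\mathcal G_R,\mathrm{box}_R)$ where $\mathcal G_R$ is a ground-structure and $\mathrm{box}_R$ maps each $!$ node $n$ of $\mathcal G_R$ to a proof-structure $\mathrm{box}_R(n)$ (its box) whose ground-structure has as many conclusions as $n$, all the sets of nodes and arcs involved being pairwise disjoint. Write $R'\sqsubset R$ if $R'=\mathrm{box}_R(n)$ for some $!$ node $n$ of $\mathcal G_R$. Formulae. Atomic formulae form a countably infinite set with a fixed-point-free involution $X\mapsto X^\bot$, and are split into two disjoint classes exchanged by it. $\mathsf{MELL}$ formulae: $A::=X\mid\mathbf 1\mid\bot\mid A\otimes A\mid A\wp A\mid {!A}\mid{?A}$, with linear negation the involution given by $\mathbf 1^\bot=\bot$, $(A\otimes B)^\bot=A^\bot\wp B^\bot$, $(!A)^\bot={?A^\bot}$. The fragment $\mathsf{IMELL}$ consists of the output formulae $O::=X\mid\mathbf 1\mid O\otimes O\mid O\wp I\mid I\wp O\mid{!O}$ and the input formulae $I::=X^\bot\mid\bot\mid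 I\wp I\mid I\otimes O\mid O\otimes I\mid{?I}$ ($X$ ranging over one class of atoms, $X^\bot$ over the other). A proof-structure of $\mathsf{IMELL}$ is a proof-structure whose arcs are labelled by $\mathsf{IMELL}$ formulae (types) so that: $\mathtt{ax}$ conclusions have types $A,A^\bot$; $\mathtt{cut}$ premises have types $A,A^\bot$; $\mathtt 1$, $\bot$ conclusions have types $\mathbf 1$, $\bot$; $\otimes$ (resp. $\wp$) with left, right premises $A,B$ has conclusion $A\otimes B$ (resp. $A\wp B$); $?\mathtt d$ with premise $A$ has conclusion ${?A}$; a $?$ node has all premises and its conclusion of a same type ${?A}$; a $!$ node has (ordered) conclusions of types ${?A_1},\dots,{?A_k},{!A}$ and its box is a proof-structure of $\mathsf{IMELL}$ with (ordered) conclusions of types ${?A_1},\dots,{?A_k},A$. Properties. A switching $\varphi$ of $\mathcal G$ maps each $\wp$ or $?\mathtt c$ node $n$ to one of its premises; $\mathcal G^\varphi$ is the graph obtained by erasing, for each such $n$, every premise of $n$ except $\varphi(n)$. $\mathcal G\models\mathsf{AC}$ if $\mathcal G^\varphi$ is acyclic for every switching $\varphi$; $\mathcal G\models\mathsf{ACC}_{\sharp\mathsf w}$ if moreover $\sharp\mathrm{cc}(\mathcal G^\varphi)=\sharp\mathsf w(\mathcal G)+1$ for every switching $\varphi$. $R$ satisfies $\mathsf{AC}$ (resp. $\mathsf{ACC}_{\sharp\mathsf w}$) if $\mathcal G_R$ does and, inductively, every $R'\sqsubset R$ does. *)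

(* Defs.v *)
From HB Require Import structures.
From mathcomp Require Import all_boot.

Set Implicit Arguments.
Unset Strict Implicit.
Unset Printing Implicit Defensive.

(* Nodes and arcs live in separate types, so disjointness is built in;
   loops and parallel arcs are allowed. *)
Record graph := Graph {
  node : finType;
  arc : finType;
  arc_tail : arc -> node;
  arc_head : arc -> node
}.

Section Graphs.
Variable G : graph.
Implicit Types (n x y : node G) (a : arc G).

Definition premises n : {set arc G} := [set a | arc_head a == n].
Definition conclusions n : {set arc G} := [set a | arc_tail a == n].

Definition joins a x y : bool :=
  (arc_tail a == x) && (arc_head a == y) || (arc_tail a == y) && (arc_head a == x).

(* An alternating sequence n_0 a_1 n_1 ... a_k n_k is encoded as the node n_0
   together with the sequence (a_1, n_1), ..., (a_k, n_k). *)
Fixpoint alternating n0 (s : seq (arc G * node G)) : bool :=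
  if s is (a, n) :: s' then joins a n0 n && alternating n s' else true.

Definition is_path n0 (s : seq (arc G * node G)) : Prop :=
  let ns := n0 :: unzip2 s in
  let k := size s in
  [/\ alternating n0 s,
      (forall i j, i < j -> j <= k -> nth n0 ns i = nth n0 ns j ->
         i = 0 /\ j = k)
    & (2 <= k -> forall a0,
         nth a0 (unzip1 s) 0 <> nth a0 (unzip1 s) k.-1)].

Definition is_cycle n0 (s : seq (arc G * node G)) : Prop :=
  [/\ is_path n0 s, 0 < size s & last n0 (unzip2 s) = n0].

Definition acyclic : Prop := forall n0 s, ~ is_cycle n0 s.

Definition adjacent : rel (node G) := fun x y => [exists a, joins a x y].

(* A connected component is identified with its (non-empty) set of nodes. *)
Definition cc : {set {set node G}} :=
  equivalence_partition (connect adjacent) [set: node G].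

End Graphs.

Inductive label :=
  Lax | Lcut | Lone | Lbot | Ltens | Lpar | Lbang | Lder | Lwn | Lconcl.

Lemma label_eq_dec (l1 l2 : label) : decidable (l1 = l2).
Proof. by rewrite /decidable; decide equality. Defined.

HB.instance Definition _ := hasDecEq.Build label (compareP label_eq_dec).

Definition arity (l : label) (p c : nat) : bool :=
  match l with
  | Lax => (p == 0) && (c == 2)
  | Lcut => (p == 2) && (c == 0)
  | Lone | Lbot => (p == 0) && (c == 1)
  | Ltens | Lpar => (p == 2) && (c == 1)
  | Lbang => (p == 0) && (1 <= c)
  | Lder => (p == 1) && (c == 1)
  | Lwn => c == 1
  | Lconcl => (p == 1) && (c == 0)
  end.

(* A total order on a finite set is given as its increasing enumeration. *)
Definition enumerates (T : finType) (s : seq T) (A : {set T}) : Prop :=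
  uniq s /\ s =i A.

Record ground_structure := GroundStructure {
  gs_graph :> graph;
  lab : node gs_graph -> label;
  gs_arity : forall n, arity (lab n) #|premises n| #|conclusions n|;
  gs_concl : seq (arc gs_graph);
  gs_conclP : enumerates gs_concl [set a | lab (arc_head a) == Lconcl];
  bang_concl : {n | lab n == Lbang} -> seq (arc gs_graph);
  bang_conclP : forall n, enumerates (bang_concl n) (conclusions (val n));
  left_prem : {n | lab n \in [:: Ltens; Lpar]} -> arc gs_graph;
  right_prem : {n | lab n \in [:: Ltens; Lpar]} -> arc gs_graph;
  mult_premP : forall n,
    enumerates [:: left_prem n; right_prem n] (premises (val n))
}.

Definition bang_node (G : ground_structure) : Type :=
  {n : node G | lab n == Lbang}.

(* [proof_structure k] is the type of proof-structures with k conclusions.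
   Each box comes with its own types of nodes and arcs, hence the disjointness
   of all the sets involved is built in. *)
Inductive proof_structure : nat -> Type :=
  ProofStructure (G : ground_structure)
    (box : forall n : bang_node G, proof_structure #|conclusions (val n)|) :
    proof_structure (size (gs_concl G)).

Definition ground k (R : proof_structure k) : ground_structure :=
  let: ProofStructure G _ := R in G.

Section Formulae.

(* [atom_out] is one of the two classes; the other one is its complement. *)
Record atom_system := AtomSystem {
  atom : countType;
  atom_infinite : forall s : seq atom, exists x, x \notin s;
  atom_dual : atom -> atom;
  atom_dualK : involutive atom_dual;
  atom_dual_neq : forall x, atom_dual x != x;
  atom_out : pred atom;
  atom_out_dual : forall x, atom_out (atom_dual x) = ~~ atom_out x
}.

Variable Atoms : atom_system.

Inductive formula :=
  | Atom of atom Atoms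
  | One
  | Bot
  | Tensor of formula & formula
  | Par of formula & formula
  | OfCourse of formula
  | WhyNot of formula.

Fixpoint dual (F : formula) : formula :=
  match F with
  | Atom x => Atom (atom_dual x)
  | One => Bot
  | Bot => One
  | Tensor A B => Par (dual A) (dual B)
  | Par A B => Tensor (dual A) (dual B)
  | OfCourse A => WhyNot (dual A)
  | WhyNot A => OfCourse (dual A)
  end.

Fixpoint output (F : formula) : bool :=
  match F with
  | Atom x => atom_out x
  | One => true
  | Bot => false
  | Tensor A B => output A && output B
  | Par A B => output A && input B || input A && output B
  | OfCourse A => output A
  | WhyNot _ => false
  end
with input (F : formula) : bool :=
  match F with
  | Atom x => ~~ atom_out x
  | One => false
  | Bot => true
  | Tensor A B => input A && output B || output A && input B
  | Par A B => input A && input B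
  | OfCourse _ => false
  | WhyNot A => input A
  end.

Definition imell (F : formula) : bool := output F || input F.

(* Assignments of formulae to the arcs of the ground-structure and,
   hereditarily, to the arcs of the boxes. *)
Fixpoint typing k (R : proof_structure k) : Type :=
  let: ProofStructure G box := R in
  ((arc G -> formula) * (forall n : bang_node G, typing (box n)))%type.

Definition ground_type k (R : proof_structure k) :
    typing R -> arc (ground R) -> formula :=
  match R return typing R -> arc (ground R) -> formula with
  | ProofStructure G box => fun t => t.1
  end.

Record ground_well_typed (G : ground_structure) (ty : arc G -> formula) :
    Prop := GroundWellTyped {
  wt_imell : forall a, imell (ty a);
  wt_ax : forall n, lab n = Lax ->
    {in conclusions n &, forall a b, a != b -> ty b = dual (ty a)};
  wt_cut : forall n, lab n = Lcut ->
    {in premises n &, forall a b, a != b -> ty b = dual (ty a)};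
  wt_one : forall n, lab n = Lone -> {in conclusions n, forall c, ty c = One};
  wt_bot : forall n, lab n = Lbot -> {in conclusions n, forall c, ty c = Bot};
  wt_tens : forall n : {n : node G | lab n \in [:: Ltens; Lpar]},
    lab (val n) = Ltens -> {in conclusions (val n), forall c,
      ty c = Tensor (ty (left_prem n)) (ty (right_prem n))};
  wt_par : forall n : {n : node G | lab n \in [:: Ltens; Lpar]},
    lab (val n) = Lpar -> {in conclusions (val n), forall c,
      ty c = Par (ty (left_prem n)) (ty (right_prem n))};
  wt_der : forall n, lab n = Lder ->
    {in premises n & conclusions n, forall p c, ty c = WhyNot (ty p)};
  wt_wn : forall n, lab n = Lwn ->
    exists A, {in premises n :|: conclusions n, forall a, ty a = WhyNot A}
}.

Fixpoint well_typed k (R : proof_structure k) : typing R -> Prop :=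
  match R return typing R -> Prop with
  | ProofStructure G box => fun t =>
      ground_well_typed t.1 /\
      forall n : bang_node G,
        (exists (As : seq formula) (A : formula),
            map t.1 (bang_concl n) = rcons (map WhyNot As) (OfCourse A) /\
            map (ground_type (t.2 n)) (gs_concl (ground (box n)))
              = rcons (map WhyNot As) A) /\
        well_typed (t.2 n)
  end.

Record imell_proof_structure := IMELLProofStructure {
  nb_concl : nat;
  imell_ps : proof_structure nb_concl;
  imell_typing : typing imell_ps;
  imell_well_typed : well_typed imell_typing
}.

End Formulae.

Section Correctness.
Variable G : ground_structure.

Definition switched : pred (node G) := fun n =>
  (lab n == Lpar) || (lab n == Lwn) && (2 <= #|premises n|).

Record switching := Switching {
  switch :> {n | switched n} -> arc G;
  switchP : forall n, switch n \in premises (val n)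
}.

Definition kept (phi : switching) : pred (arc G) := fun a =>
  [forall n, (a \in premises (val n)) ==> (a == phi n)].

Definition switching_graph (phi : switching) : graph :=
  @Graph (node G) {a | kept phi a}
    (fun a => arc_tail (val a)) (fun a => arc_head (val a)).

Definition weakenings : {set node G} :=
  [set n | (lab n == Lbot) || (lab n == Lwn) && (#|premises n| == 0)].

Definition sat_AC : Prop := forall phi, acyclic (switching_graph phi).

Definition sat_ACCw : Prop :=
  sat_AC /\ forall phi, #|cc (switching_graph phi)| = #|weakenings| + 1.

End Correctness.

Fixpoint satisfies (P : ground_structure -> Prop) k (R : proof_structure k) :
    Prop :=
  let: ProofStructure G box := R in
  P G /\ forall n : bang_node G, satisfies P (box n).

Definition output_concl_nodes (Atoms : atom_system)
    (R : imell_proof_structure Atoms) : {set node (ground (imell_ps R))} :=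
  [set n | (lab n == Lconcl) &&
     [exists a in premises n, output (ground_type (imell_typing R) a)]].

(* Main.v *)
(* An acyclic graph has as many nodes as arcs and connected components together.
   The number of arcs kept by a switching does not depend on the switching, so
   under AC the number of components of every switching graph is the same
   number.  Every arc is either input or output, and at every node the number
   of output premises minus that of output conclusions is forced by the label;
   summing over all nodes, that number of components is the number of weakenings
   plus the number of output conclusions.  The box of a ! node has conclusions
   ?A_1, ..., ?A_k, A with !A in IMELL, hence exactly one output conclusion, so
   the condition on the number of outputs holds by itself inside boxes. *)

From mathcomp Require Import all_boot.
From mathcomp Require Import zify.
Require Import Defs.

Set Implicit Arguments.
Unset Strict Implicit.
Unset Printing Implicit Defensive.

(** * Counting the connected components of a relation on a finite type *)

Section Components.
Variable T : finType.
Implicit Types (e : rel T) (x y u v : T).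

Definition component e u : {set T} := [set v | connect e u v].

Definition components e : {set {set T}} := [set component e u | u : T].

Lemma mem_components e u : component e u \in components e.
Proof. exact: imset_f. Qed.

Lemma eq_components e e' : e =2 e' -> components e = components e'.
Proof.
by move=> eq_e; apply: eq_imset => u; apply/setP=> v; rewrite !inE (eq_connect eq_e).
Qed.

Lemma component_eq e u v :
  connect_sym e -> (component e u == component e v) = connect e u v.
Proof.
move=> symc; apply/eqP/idP => [E|uv].
  by have := connect0 e v; rewrite -[connect e v v]in_set -/(component e v) -E inE.
by apply/setP=> z; rewrite !inE (same_connect symc uv).
Qed.

(** Components are the fibres of [f], and distinct values in its image have distinct fibres. *)
Lemma card_components (rT : finType) (f : T -> rT) e :
  (forall u v, connect e u v = (f u == f v)) ->
  #|components e| = #|[set f u | u : T]|.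
Proof.
move=> ker_f; pose g c := [set v | c == f v].
have -> : components e = g @: [set f u | u : T].
  rewrite /components -imset_comp; apply: eq_imset => u.
  by apply/setP=> v; rewrite !inE ker_f.
rewrite card_in_imset // => _ _ /imsetP[u _ ->] /imsetP[v _ ->] /setP/(_ u).
by rewrite !inE eqxx => /esym/eqP.
Qed.

Lemma components_add_edge e x y :
    symmetric e -> ~~ connect e x y ->
  #|components e| =
    #|components (fun u v => [|| e u v, (u == x) && (v == y)
                                      | (u == y) && (v == x)])|.+1.
Proof.
move=> syme nxy; set e' := fun u v => _.
have symc := sym_connect_sym syme.
have symc' : connect_sym e'.
  apply: sym_connect_sym => u v; rewrite /e' syme.
  by congr (_ || _); rewrite orbC andbC [X in _ || X]andbC.
(* [rep] moves the component of [y] to [x]: two nodes are [e']-connected exactly when their images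
   under [rep] share an [e]-component. *)
pose rep u := if connect e y u then x else u.
have sub_ee' u v : connect e u v -> connect e' u v.
  by apply: connect_sub => a b eab; apply: connect1; rewrite /e' eab.
have rep_e' u : connect e' u (rep u).
  rewrite /rep; case: ifP => // yu; rewrite symc'.
  apply: connect_trans (sub_ee' _ _ yu).
  by apply: connect1; rewrite /e' !eqxx orbT.
have rep_x : rep x = x by rewrite /rep; case: ifP.
have rep_y : rep y = x by rewrite /rep connect0.
rewrite (@card_components _ (fun u => component e (rep u)) e'); last first.
  move=> u v; apply/idP/idP => [/connectP[p]|].
    elim: p u => [u _ -> //|w p IHp u] /= /andP[uw /IHp{}IHp /IHp/eqP<-] {IHp}.
    case/or3P: uw => [/connect1 uw|/andP[/eqP-> /eqP->]|/andP[/eqP-> /eqP->]].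
    - rewrite /rep (same_connect_r symc uw); case: ifP => // _.
      by rewrite component_eq.
    - by rewrite rep_x rep_y.
    - by rewrite rep_x rep_y.
  rewrite component_eq // => /sub_ee' uv.
  apply: connect_trans (rep_e' u) (connect_trans uv _).
  by rewrite symc'; apply: rep_e'.
(* The sets [component e (rep u)] are the [e]-components other than that of [y]. *)
rewrite [in LHS](cardsD1 (component e y)) mem_components add1n; congr _.+1.
apply: eq_card => B; rewrite !inE.
apply/andP/imsetP => [[nB /imsetP[u _ EB]]|[u _ ->]].
  exists u => //; rewrite {}EB component_eq // symc in nB *.
  by rewrite /rep (negPf nB).
rewrite mem_components component_eq // symc /rep; split=> //.
by case: ifP => [_|->//]; rewrite symc.
Qed.

End Components.

(** * Forests: nodes, arcs and connected components *)

Section Forests.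
Variable G : graph.
Implicit Types (S : {set arc G}) (x y : node G).

Definition adjacent_in S : rel (node G) :=
  fun x y => [exists a in S, joins a x y].

Lemma joinsC (a : arc G) : symmetric (joins a).
Proof. by move=> x y; rewrite /joins orbC. Qed.

Lemma adjacent_in_sym S : symmetric (adjacent_in S).
Proof. by move=> x y; apply: eq_existsb => a; rewrite joinsC. Qed.

(** Forests are expressed through connectivity, so that arcs can be removed one at a time without
    handling cycles. *)
Definition bridges S := forall a, a \in S ->
  ~~ connect (adjacent_in (S :\ a)) (arc_tail a) (arc_head a).

Lemma bridges_sub S S' : S \subset S' -> bridges S' -> bridges S.
Proof.
move=> sSS' brS' a aS; apply: contra (brS' a (subsetP sSS' a aS)).
apply: connect_sub => u v /exists_inP[b bS buv]; apply: connect1.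
by apply/exists_inP; exists b => //; apply: subsetP bS; apply: setSD.
Qed.

(** Removing a bridge splits one component in two, which keeps the sum constant; with no arcs left,
    every node is its own component. *)
Lemma bridges_card S :
  bridges S -> #|components (adjacent_in S)| + #|S| = #|node G|.
Proof.
have [n] := ubnP #|S|; elim: n S => // n IHn S leSn brS.
have [->|[a aS]] := set_0Vmem S.
  rewrite cards0 addn0 (@card_components _ _ id); first by rewrite card_imset.
  move=> u v; apply/idP/eqP => [/connectP[[|w p] /= + ->] //|->//].
  by case/andP=> /exists_inP[b]; rewrite inE.
have cardS : #|S| = #|S :\ a|.+1 by rewrite (cardsD1 a) aS.
have ltSn : #|S :\ a| < n by rewrite -cardS.
rewrite -(IHn _ ltSn (bridges_sub (subD1set S a) brS)) cardS.
rewrite (components_add_edge (adjacent_in_sym (S :\ a)) (brS a aS)) addSnnS.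
congr (#|pred_of_set _| + _); apply: eq_components => u v.
rewrite eq_sym (eq_sym v) (eq_sym u (arc_head a)) (eq_sym v (arc_tail a)).
rewrite [X in _ || (_ || X)]andbC -/(joins a u v).
apply/exists_inP/orP => [[b bS buv]|[/exists_inP[b]|auv]].
- have [<-|nba] := eqVneq b a; [by right | left].
  by apply/exists_inP; exists b; rewrite // !inE nba.
- by rewrite !inE => /andP[_ bS] buv; exists b.
- by exists a.
Qed.

Lemma alternating_lift S x p : path (adjacent_in S) x p ->
  exists s : seq (arc G * node G),
    [/\ unzip2 s = p, alternating x s & all (mem S) (unzip1 s)].
Proof.
elim: p x => [x _|y p IHp x /= /andP[/exists_inP[a aS axy] /IHp[s [<- alt_s sS]]]].
  by exists [::].
by exists ((a, y) :: s); rewrite /= axy aS.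
Qed.

Lemma acyclic_bridges : acyclic G -> bridges [set: arc G].
Proof.
move=> acG a _; apply/negP.
rewrite (sym_connect_sym (adjacent_in_sym _)).
case/connectP=> p0 /shortenP[p path_p uniq_p _] last_p {p0}.
have [s [Dp alt_s s_a]] := alternating_lift path_p.
(* The cycle crosses [a], then returns from its head to its tail along a path without repetition
   that avoids [a]. *)
apply: (acG (arc_tail a) ((a, arc_head a) :: s)); split=> //=; last by rewrite Dp.
have szp : size s = size p by rewrite -Dp size_map.
split=> /=; first by rewrite /joins !eqxx.
- rewrite Dp szp => -[|i] [|j] //= ltij lej; last first.
    by move/eqP; rewrite nth_uniq //= ?ltnS //; lia.
  (* Case [i = 0]: the repeated node [arc_tail a] is the last of the duplicate-free list
     [arc_head a :: p], which forces [j] to be the final index. *)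
  have Et : nth (arc_tail a) (arc_head a :: p) (size p) = arc_tail a.
    by rewrite [RHS]last_p -nth_last /=; case: (p) => //= y q; apply: set_nth_default.
  by rewrite -[X in X = _]Et => /eqP; rewrite nth_uniq //= => /eqP<-.
- move=> s_gt0 a0; rewrite -[size s]prednK //= => Ea.
  have : nth a0 (unzip1 s) (size s).-1 \in [set: arc G] :\ a.
    by apply: (allP s_a); apply: mem_nth; rewrite size_map prednK.
  by rewrite -Ea !inE eqxx.
Qed.

Lemma acyclic_card_cc : acyclic G -> #|cc G| + #|arc G| = #|node G|.
Proof.
move/acyclic_bridges/bridges_card; rewrite cardsT => <-; congr (_ + _).
have -> : cc G = components (@adjacent G).
  have Du u : [set v in [set: node G] | connect (@adjacent G) u v]
      = component (@adjacent G) u by apply/setP=> v; rewrite !inE.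
  by apply/setP=> B; apply/imsetP/imsetP=> -[u _ ->]; exists u; rewrite ?Du ?inE.
congr #|pred_of_set _|; apply: eq_components => u v.
by apply: eq_existsb => a; rewrite inE.
Qed.

Lemma sum_premises (F : arc G -> nat) :
  \sum_(n : node G) \sum_(a in premises n) F a = \sum_a F a.
Proof.
rewrite [RHS](partition_big (@arc_head G) predT) //=.
by apply: eq_bigr => n _; apply: eq_bigl => a; rewrite inE.
Qed.

Lemma sum_conclusions (F : arc G -> nat) :
  \sum_(n : node G) \sum_(a in conclusions n) F a = \sum_a F a.
Proof.
rewrite [RHS](partition_big (@arc_tail G) predT) //=.
by apply: eq_bigr => n _; apply: eq_bigl => a; rewrite inE.
Qed.

End Forests.

(** * Input and output formulae under negation *)

Section Polarity.
Variable Atoms : atom_system.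
Implicit Types F : formula Atoms.

Lemma dual_polarity F : output (dual F) = input F /\ input (dual F) = output F.
Proof.
elim: F => [x|||A [oA iA] B [oB iB]|A [oA iA] B [oB iB]|A [oA iA]|A [oA iA]] //=.
- by rewrite atom_out_dual negbK.
- by rewrite oA iA oB iB.
- by rewrite oA iA oB iB.
Qed.

Lemma polarity_exclusive F : ~~ (output F && input F).
Proof.
elim: F => [x|||A + B|A + B|F _|F _] //=; rewrite ?andbN ?andbF //;
  by case: (output A); case: (input A); case: (output B); case: (input B).
Qed.

Lemma imell_input F : imell F -> input F = ~~ output F.
Proof.
by rewrite /imell; have := polarity_exclusive F; case: (output F); case: (input F).
Qed.

Lemma output_dual F : imell F -> output (dual F) = ~~ output F.
Proof. by move=> iF; rewrite (dual_polarity F).1 imell_input. Qed.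

Lemma output_OfCourse F : imell (OfCourse F) -> output F.
Proof. by rewrite /imell /= orbF. Qed.

Lemma count_output_WhyNot (As : seq (formula Atoms)) F :
  count (@output Atoms) (rcons (map (@WhyNot Atoms) As) F) = output F.
Proof. by rewrite -cats1 count_cat /= addn0 count_map; elim: As. Qed.

End Polarity.

(** * Existence of switchings and the number of arcs they keep *)

Section Switchings.
Variable G : ground_structure.
Implicit Types n : node G.

Lemma switched_premise n : switched n -> exists a, a \in premises n.
Proof.
move=> sw_n; apply/set0Pn; rewrite -card_gt0.
case/orP: sw_n => [/eqP Dn|/andP[_ /ltnW //]].
by have := gs_arity n; rewrite Dn => /andP[/eqP-> _].
Qed.

(** The component count in [sat_ACCw] would be vacuous without a switching. *)
Lemma switching_exists : inhabited (switching G).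
Proof.
pose f (n : {n : node G | switched n}) := xchoose (switched_premise (valP n)).
by split; apply: (@Switching G f) => n; apply: xchooseP.
Qed.

Definition kept_premises n := if switched n then 1 else #|premises n|.

(** Kept arcs are grouped by head: a switched node keeps only the premise chosen by [phi], any other
    node keeps all of its premises. *)
Lemma card_kept (phi : switching G) :
  #|arc (switching_graph phi)| = \sum_n kept_premises n.
Proof.
rewrite card_sig -sum1_card big_mkcond -sum_premises.
apply: eq_bigr => n _; rewrite /kept_premises -big_mkcondr /= sum1_card.
case: ifP => sw_n.
  pose m : {n | switched n} := Sub n sw_n.
  rewrite -[RHS](card1 (phi m)); apply: eq_card => a; rewrite !inE.
  apply/andP/eqP => [[an /forallP/(_ m)]|->]; first by rewrite an => /eqP.
  have hn := switchP phi m; split=> //; apply/forallP=> m'.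
  apply/implyP; move: hn; rewrite !inE => /eqP-> /eqP mm'.
  by apply/eqP; congr (phi _); apply: val_inj.
apply: eq_card => a; rewrite unfold_in; apply: andb_idr => an.
apply/forallP=> m; apply/implyP; move: an; rewrite !inE => /eqP-> /eqP nm.
by case/negP: (negbT sw_n); rewrite nm; apply: valP.
Qed.

End Switchings.

(** * Balance of output arcs in a ground-structure *)

Section OutputCount.
Variables (Atoms : atom_system) (G : ground_structure).
Variable ty : arc G -> formula Atoms.
Hypothesis wt_ty : ground_well_typed ty.
(** [ground_well_typed] has no clause for [!] nodes, whose typing refers to their boxes; this is the
    fact about them that the count requires. *)
Hypothesis bang_output : forall n : bang_node G,
  count (@output Atoms) (map ty (bang_concl n)) = 1.

Let out_premises n := \sum_(a in premises n) output (ty a).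
Let out_conclusions n := \sum_(a in conclusions n) output (ty a).

Lemma sum_output_pair (A : {set arc G}) : #|A| == 2 ->
  {in A &, forall a b, a != b -> ty b = dual (ty a)} ->
  \sum_(a in A) output (ty a) = 1.
Proof.
case/cards2P=> [a [b [nab ->]]] dualP.
have Eb : ty b = dual (ty a) by apply: dualP; rewrite ?inE ?eqxx ?orbT.
rewrite big_setU1 ?inE // big_set1 Eb.
by rewrite output_dual ?(wt_imell wt_ty) //; case: output.
Qed.

Lemma sum_output_enum (s : seq (arc G)) (A : {set arc G}) : enumerates s A ->
  \sum_(a in A) output (ty a) = count (@output Atoms) (map ty s).
Proof.
case=> uniq_s sA; rewrite -(eq_bigl _ _ sA) -big_uniq //= count_map.
by rewrite -sum1_count [RHS]big_mkcond; apply: eq_bigr => a _ /=; case: output.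
Qed.

Lemma sum_output_single (A : {set arc G}) (b : bool) : #|A| == 1 ->
  {in A, forall a, output (ty a) = b} -> \sum_(a in A) output (ty a) = b.
Proof.
by case/cards1P=> a -> /(_ a); rewrite inE eqxx big_set1 => /(_ isT) ->.
Qed.

Lemma sum_output0 (A : {set arc G}) :
  {in A, forall a, output (ty a) = false} -> \sum_(a in A) output (ty a) = 0.
Proof. by move=> A0; apply: big1 => a /A0->. Qed.

(** Local contribution to the global count, checked label by label and stated without subtraction.
    The leading [1] counts the node itself; the last term compensates for conclusion nodes, whose
    output premises are not otherwise balanced. *)
Lemma node_balance n :
  1 + out_premises n = kept_premises n + (n \in weakenings G) +
    out_conclusions n + (if lab n == Lconcl then out_premises n else 0).
Proof.
have := gs_arity n; have := @wt_ax _ _ _ wt_ty n; have := @wt_cut _ _ _ wt_ty n.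
have := @wt_one _ _ _ wt_ty n; have := @wt_bot _ _ _ wt_ty n.
have := @wt_der _ _ _ wt_ty n; have := @wt_wn _ _ _ wt_ty n.
have wtM (hn : lab n \in [:: Ltens; Lpar]) := wt_tens wt_ty (n := exist _ n hn).
have wtP (hn : lab n \in [:: Ltens; Lpar]) := wt_par wt_ty (n := exist _ n hn).
have prem0 : #|premises n| == 0 -> out_premises n = 0.
  by rewrite cards_eq0 /out_premises => /eqP->; rewrite big_set0.
have concl0 : #|conclusions n| == 0 -> out_conclusions n = 0.
  by rewrite cards_eq0 /out_conclusions => /eqP->; rewrite big_set0.
have multP (hn : lab n \in [:: Ltens; Lpar]) :
    out_premises n = output (ty (left_prem (exist _ n hn)))
                   + output (ty (right_prem (exist _ n hn))).
  rewrite /out_premises (sum_output_enum (mult_premP (exist _ n hn))) /=.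
  by rewrite addn0.
have imE a := wt_imell wt_ty a.
rewrite /kept_premises /switched inE.
case Dn: (lab n) => wn der bot one cut ax /=.
- case/andP=> p0 c2; rewrite (prem0 p0) (eqP p0).
  by rewrite /out_conclusions (sum_output_pair c2 (ax erefl)).
- case/andP=> p2 c0; rewrite (concl0 c0) (eqP p2).
  by rewrite /out_premises (sum_output_pair p2 (cut erefl)).
- case/andP=> p0 c1; rewrite (prem0 p0) (eqP p0) /out_conclusions.
  by rewrite (sum_output_single (b := true) c1) // => a /(one erefl)->.
- case/andP=> p0 c1; rewrite (prem0 p0) (eqP p0) /out_conclusions.
  by rewrite (sum_output_single (b := false) c1) // => a /(bot erefl)->.
- case/andP=> p2 /cards1P[c Ec]; rewrite (eqP p2) /out_conclusions Ec big_set1.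
  have hn : lab n \in [:: Ltens; Lpar] by rewrite Dn.
  have Ety : ty c = Tensor (ty (left_prem (exist _ n hn)))
                           (ty (right_prem (exist _ n hn))).
    by apply: (wtM hn); rewrite //= Ec inE.
  have := imE c; have inL := imE (left_prem (exist _ n hn)).
  have inR := imE (right_prem (exist _ n hn)).
  (* IMELL excludes a tensor of two inputs: at least one premise is output, and the conclusion is
     output when both are. *)
  rewrite (multP hn) Ety /imell /= !imell_input //.
  by case: output; case: output.
- case/andP=> _ /cards1P[c Ec]; rewrite /out_conclusions Ec big_set1.
  have hn : lab n \in [:: Ltens; Lpar] by rewrite Dn.
  have Ety : ty c = Par (ty (left_prem (exist _ n hn)))
                           (ty (right_prem (exist _ n hn))).
    by apply: (wtP hn); rewrite //= Ec inE.
  have := imE c; have inL := imE (left_prem (exist _ n hn)).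
  have inR := imE (right_prem (exist _ n hn)).
  (* IMELL excludes a par of two outputs: the conclusion is output exactly when one premise is. *)
  rewrite (multP hn) Ety /imell /= !imell_input //.
  by case: output; case: output.
- case/andP=> p0 c1; rewrite (prem0 p0) (eqP p0) /out_conclusions.
  have hn : lab n == Lbang by rewrite Dn.
  by rewrite (sum_output_enum (bang_conclP (exist _ n hn))) bang_output.
- case/andP=> p1 /cards1P[c Ec]; rewrite (eqP p1) /out_conclusions Ec big_set1.
  have [q Eq] := cards1P p1; rewrite /out_premises Eq big_set1.
  have Ec' : ty c = WhyNot (ty q) by apply: der; rewrite // (Eq, Ec) set11.
  have := imE c; have := imE q; rewrite Ec' /imell /= => iq.
  by rewrite imell_input //; case: output.
(* All arcs here are input. The node counts as a weakening if it has no premise, and otherwise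
   exactly one premise is kept. *)
- move=> _; have [A tyA] := wn erefl.
  rewrite /out_premises /out_conclusions !sum_output0.
  + by case: #|premises n| => [|[|p]].
  + by move=> a na; rewrite tyA // inE na orbT.
  + by move=> a na; rewrite tyA // inE na.
- case/andP=> p1 c0; rewrite (concl0 c0) (eqP p1); lia.
Qed.

(** Summing [node_balance] over all nodes, the output premises and output conclusions cancel, as
    each arc has one head and one tail; acyclicity turns nodes minus kept arcs into components. *)
Lemma output_balance (phi : switching G) : acyclic (switching_graph phi) ->
  #|cc (switching_graph phi)| = #|weakenings G| +
    \sum_(n | lab n == Lconcl) out_premises n.
Proof.
move/acyclic_card_cc; rewrite card_kept /= => nodesE.
have weakE : \sum_(n : node G) (n \in weakenings G : nat) = #|weakenings G|.
  by rewrite -sum1_card [RHS]big_mkcond; apply: eq_bigr => n _; case: ifP.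
have := eq_bigr (op := addn) (idx := 0) (r := index_enum _) (P := predT) _
  (fun n _ => node_balance n).
rewrite !big_split /= /out_premises /out_conclusions sum_premises sum_conclusions.
rewrite sum_nat_const muln1 weakE -nodesE => balance.
rewrite [X in _ = _ + X]big_mkcond /=; lia.
Qed.

Lemma sum_output_concl :
  \sum_(n | lab n == Lconcl) out_premises n
    = count (@output Atoms) (map ty (gs_concl G)).
Proof.
rewrite -(sum_output_enum (gs_conclP G)).
rewrite [RHS](partition_big (@arc_head G) (fun n => lab n == Lconcl)) /=; last first.
  by move=> a; rewrite inE.
apply: eq_bigr => n ln; apply: eq_bigl => a; rewrite !inE.
by case: eqP => [->|]; rewrite ?ln ?andbF.
Qed.

Lemma card_output_concl :
  #|[set n | (lab n == Lconcl) && [exists a in premises n, output (ty a)]]|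
    = count (@output Atoms) (map ty (gs_concl G)).
Proof.
rewrite -sum_output_concl -sum1_card big_mkcond [RHS]big_mkcond.
apply: eq_bigr => n _; rewrite inE; case Dn: (lab n == Lconcl) => //=.
have := gs_arity n; rewrite (eqP Dn) => /andP[/cards1P[a Ea] _].
rewrite /out_premises Ea big_set1.
have -> : [exists b in [set a], output (ty b)] = output (ty a).
  by apply/exists_inP/idP => [[b /set1P->]//|oa]; exists a; rewrite ?set11.
by case: output.
Qed.

Lemma ACCw_outputs : sat_ACCw G <->
  sat_AC G /\ count (@output Atoms) (map ty (gs_concl G)) = 1.
Proof.
rewrite -sum_output_concl; split=> [[acG ccG]|[acG o1]]; split=> //.
  have [phi] := switching_exists G; have := ccG phi.
  by rewrite output_balance // => /addnI.
by move=> phi; rewrite output_balance // o1.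
Qed.

End OutputCount.

(** * Induction on the nesting of boxes *)

Lemma satisfies_ACCw (Atoms : atom_system) k (R : proof_structure k)
    (t : typing Atoms R) : well_typed t ->
  satisfies sat_ACCw R <-> satisfies sat_AC R /\
    count (@output Atoms) (map (ground_type t) (gs_concl (ground R))) = 1.
Proof.
elim: R t => G box IH [ty tbox] /= [wtG wt_box].
(* The two lists of types differ only in their last entry, [!A] against [A]; both are output since
   [!A] is in IMELL, and the other entries are input. *)
have one_out n : count (@output Atoms) (map ty (bang_concl n)) = 1 /\
    count (@output Atoms)
      (map (ground_type (tbox n)) (gs_concl (ground (box n)))) = 1.
  have [[As [A [bangE boxE]]] _] := wt_box n.
  suff outA : output A by rewrite bangE boxE !count_output_WhyNot /= outA.
  have : all (@imell Atoms) (map ty (bang_concl n)).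
    by rewrite all_map; apply/allP => a _; apply: (wt_imell wtG).
  by rewrite bangE all_rcons => /andP[/output_OfCourse].
(* By [one_out] the output condition of the induction hypothesis is automatic in a box. *)
have boxP n : satisfies sat_ACCw (box n) <-> satisfies sat_AC (box n).
  have [_ wt_n] := wt_box n; have [_ box1] := one_out n.
  by rewrite (IH n _ wt_n); split=> [[]|].
rewrite (ACCw_outputs wtG) => [|n]; last by have [] := one_out n.
split=> [[[acG ->] acB]|[[acG acB] ->]]; split=> //.
  by split=> [//|n]; exact: (boxP n).1 (acB n).
by move=> n; exact: (boxP n).2 (acB n).
Qed.

Theorem corollary31 (Atoms : atom_system) (R : imell_proof_structure Atoms) :
  satisfies sat_ACCw (imell_ps R) <->
  satisfies sat_AC (imell_ps R) /\ #|output_concl_nodes R| = 1.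
Proof.
rewrite card_output_concl; exact: satisfies_ACCw (imell_well_typed R).
Qed.
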